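(* Let $M$ be a Riemann surface and $\Omega$ be an open subset of $M$. Let $u$ and $v$ be two continuous real-valued functions on $\Omega$ that are subharmonic and superharmonic, respectively. Suppose that $v:\Omega\to(\inf_\Omega v,\sup_\Omega v)$ is proper and that $M_v(u,t)=\max_{x\in S_v(t)}u(x)$ is an increasing function of $t\in(\inf_\Omega v,\sup_\Omega v)$, where $S_v(t)=\{x\in\Omega \mid v(x)=t\}$. Then $M_v(u,t)$ is a convex function of $t\in(\inf_\Omega v,\sup_\Omega v)$.
   Context: The assumption on $v$ includes that $v$ takes values in the open interval $(\inf_\Omega v,\sup_\Omega v)$ (whose endpoints may be infinite), and proper means that preimages of compact subsets of this open interval are compact. ''Increasing'' is understood in the weak sense: $M_v(u,t)\leq M_v(u,s)$ whenever $t\leq s$. *)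

(* Defs.v *)
From HB Require Import structures.
From mathcomp Require Import all_boot all_order all_algebra.
From mathcomp Require Import all_classical all_reals all_analysis.
From mathcomp Require Import complex.

Set Implicit Arguments.
Unset Strict Implicit.
Unset Printing Implicit Defensive.

Import Order.TTheory GRing.Theory Num.Theory.
Import numFieldNormedType.Exports.

Local Open Scope classical_set_scope.
Local Open Scope ring_scope.

(* The bare type [R[i]] carries no topology; its regular module [R[i]^o] is
   the normed space over itself whose topology is the usual one of the plane. *)
Notation Cplx R := ((R[i] : Type)^o) (only parsing).

(* A chart is a homeomorphism from an open subset of M onto an open subset of
   the plane; [chart_map] and [chart_inv] are total functions whose values
   outside [chart_dom] and [chart_cod] are irrelevant. *)
Record chart (R : realType) (M : topologicalType) := Chart {
  chart_dom : set M;
  chart_cod : set (Cplx R);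
  chart_map : M -> Cplx R;
  chart_inv : Cplx R -> M;
  chart_dom_open : open chart_dom;
  chart_cod_open : open chart_cod;
  chart_mapP : {homo chart_map : x / chart_dom x >-> chart_cod x};
  chart_invP : {homo chart_inv : z / chart_cod z >-> chart_dom z};
  chart_mapK : {in chart_dom, cancel chart_map chart_inv};
  chart_invK : {in chart_cod, cancel chart_inv chart_map};
  chart_map_continuous : {within chart_dom, continuous chart_map};
  chart_inv_continuous : {within chart_cod, continuous chart_inv}
}.

(* Complex differentiability: the difference quotient is taken over the field
   [R[i]], with complex increments. *)
Definition holomorphic (R : realType) (D : set (Cplx R))
    (f : Cplx R -> Cplx R) :=
  forall z, D z -> derivable f z 1.

Record riemannSurface (R : realType) := RiemannSurface {
  rs_space :> topologicalType;
  rs_hausdorff : hausdorff_space rs_space;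
  rs_connected : connected [set: rs_space];
  rs_atlas : set (chart R rs_space);
  rs_cover : forall x, exists2 c, rs_atlas c & chart_dom c x;
  rs_transition : forall c d, rs_atlas c -> rs_atlas d ->
    holomorphic (chart_map c @` (chart_dom c `&` chart_dom d))
                (chart_map d \o chart_inv c)
}.

Arguments rs_atlas {R} _.

Definition upper_semicontinuous_on (R : realType) (T : topologicalType)
    (D : set T) (f : T -> R) :=
  forall x a, D x -> f x < a -> \forall y \near x, D y -> f y < a.

Definition circle_point (R : realType) (z : Cplx R) (r t : R) : Cplx R :=
  z + ((r * cos t) +i* (r * sin t))%C.

(* The integral is extended-real valued, so that no integrability assumption
   on the upper semicontinuous function f is hidden in the inequality. *)
Definition circle_mean (R : realType) (f : Cplx R -> R) (z : Cplx R) (r : R)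
    : \bar R :=
  (((2 * pi)^-1)%:E * \int[lebesgue_measure]_(t in `[0%R, (2 * pi)%R])
                        (f (circle_point z r t))%:E)%E.

(* Subharmonicity in an open set D of the plane: upper semicontinuity and the
   local submean inequality. *)
Definition subharmonic_plane (R : realType) (D : set (Cplx R))
    (f : Cplx R -> R) :=
  upper_semicontinuous_on D f /\
  forall z, D z -> exists2 rho : R, 0 < rho &
    forall r, 0 <= r < rho -> ((f z)%:E <= circle_mean f z r)%E.

(* Planar subharmonicity is invariant under biholomorphisms, so the choice of
   an atlas within its equivalence class is immaterial. *)
Definition subharmonic (R : realType) (M : riemannSurface R) (Omega : set M)
    (u : M -> R) :=
  forall c : chart R M, rs_atlas M c ->
    subharmonic_plane (chart_map c @` (chart_dom c `&` Omega))
                      (u \o chart_inv c).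

Definition superharmonic (R : realType) (M : riemannSurface R) (Omega : set M)
    (v : M -> R) :=
  subharmonic Omega (fun x => - v x).

Definition inf_on (R : realType) (T : Type) (Omega : set T) (v : T -> R)
    : \bar R :=
  ereal_inf [set (v x)%:E | x in Omega].

Definition sup_on (R : realType) (T : Type) (Omega : set T) (v : T -> R)
    : \bar R :=
  ereal_sup [set (v x)%:E | x in Omega].

Definition range_interval (R : realType) (T : Type) (Omega : set T)
    (v : T -> R) : set R :=
  [set t | (inf_on Omega v < t%:E < sup_on Omega v)%E].

(* v is proper as a map from Omega to J. Compactness of a subset of Omega, resp.
   J, does not depend on whether it is tested in the subspace or the ambient
   space. *)
Definition proper_on (T S : topologicalType) (Omega : set T) (J : set S)
    (v : T -> S) :=
  {homo v : x / Omega x >-> J x} /\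
  forall K : set S, compact K -> K `<=` J -> compact (Omega `&` v @^-1` K).

Definition level_set (R : realType) (T : Type) (Omega : set T) (v : T -> R)
    (t : R) : set T :=
  [set x | Omega x /\ v x = t].

(* The greatest element of A (0 if there is none). *)
Definition max_set (R : realType) (A : set R) : R :=
  xget 0 [set m | A m /\ ubound A m].

(* In the theorem the maximum always exists: v is proper and, M being connected,
   takes every value of the open interval, so level sets are compact and
   nonempty. *)
Definition level_max (R : realType) (T : Type) (Omega : set T) (u v : T -> R)
    (t : R) : R :=
  max_set (u @` level_set Omega v t).

(* Main.v *)
Require Import Defs.
From HB Require Import structures.
From mathcomp Require Import all_boot all_order all_algebra.
From mathcomp Require Import all_classical all_reals all_analysis.
From mathcomp Require Import complex lra ring.
Import Order.TTheory GRing.Theory Num.Theory.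
Import numFieldNormedType.Exports.
Local Open Scope classical_set_scope.
Local Open Scope ring_scope.

Set Implicit Arguments.
Unset Strict Implicit.
Unset Printing Implicit Defensive.

(** This is a Hadamard three-circles theorem, with the superharmonic function v
    in the role of log |z|.  Let m(t) be the maximum of u over {v = t}, let
    p < q be two values in the range interval, and let a * t + b be the affine
    function through (p, m(p)) and (q, m(q)).  Monotonicity of m enters only
    here: it gives a >= 0, so that w = u - a v is again subharmonic.  On the
    slab {p <= v <= q}, which is compact since v is proper, w is at most b on
    the two bounding level sets, and [chord_bound] extends this bound inside.
    Hence m(s) <= a * s + b for p <= s <= q, which is convexity.

    The bound is a strong maximum principle ([strong_maximum_principle]): if the
    maximum of w over the slab exceeded b, the set where it is attained would be
    compact and inside the open slab, and it would be open as well because a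
    continuous subharmonic function is constant near a local maximum.  The
    surface being connected and Hausdorff, that set would be everything, so
    v < q everywhere, whereas q < sup v.

    The same principle, applied to - v, shows that no level set over the range
    interval is empty ([level_set_neq0]), so that m is a genuine maximum even
    when the domain is disconnected.

    Constancy near a local maximum is first proved in the plane: the mean of f
    over a small circle is at least the value at the centre, f is at most that
    value on the circle, and f is continuous, so the two are equal all along the
    circle; such circles fill a disc.  Charts carry this to the surface. *)

(** * Circles in the plane *)

(** In the order of the complex numbers a positive radius is a positive real, so
    the balls of the plane are those of real radius. *)
Lemma gt0_complexP (R : realType) (e : R[i]) :
  0 < e -> 0 < complex.Re e /\ e = (complex.Re e)%:C%C.
Proof. by case: e => a b; rewrite ltcE /= => /andP[/eqP -> ->]. Qed.

Lemma complex_ball_sub (R : realType) (z : Cplx R) (A : set (Cplx R)) :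
  nbhs z A -> exists2 e : R, 0 < e & forall w, Normc.normc (w - z) < e -> A w.
Proof.
move=> /nbhs_ballP[/= e e0 zeA].
have [e0R eE] := gt0_complexP e0.
exists (complex.Re e) => // w we; apply: zeA.
rewrite -ball_normE /ball_ /= distrC eE.
rewrite normc_def ltcR.
by move: we; case: (w - z).
Qed.

Lemma nbhs_complex_ball (R : realType) (z : Cplx R) (e : R) :
  0 < e -> nbhs z [set w | Normc.normc (w - z) < e].
Proof.
move=> e0; apply/nbhs_ballP; exists (e%:C)%C => /=; first by rewrite ltcR.
move=> w; rewrite -ball_normE /ball_ /= distrC normc_def ltcR.
by case: (w - z).
Qed.

Lemma normc_circle_point (R : realType) (z : Cplx R) (r t : R) :
  Normc.normc (circle_point z r t - z) = `|r|.
Proof.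
rewrite /circle_point addrC addKr /= !exprMn -mulrDr cos2Dsin2 mulr1.
by rewrite sqrtr_sqr.
Qed.

Lemma continuous_circle_point (R : realType) (z : Cplx R) (r : R) :
  continuous (circle_point z r).
Proof.
move=> t; apply/cvg_ballP => /= e e0.
have [e0R eE] := gt0_complexP e0.
have hc : {for t, continuous (fun s : R => r * cos s)}.
  by apply: continuousM; [exact: cst_continuous|exact: continuous_cos].
have hs : {for t, continuous (fun s : R => r * sin s)}.
  by apply: continuousM; [exact: cst_continuous|exact: continuous_sin].
have e20 : 0 < complex.Re e / 2 by rewrite divr_gt0.
move/cvgrPdist_lt : hc => /(_ _ e20) hc.
move/cvgrPdist_lt : hs => /(_ _ e20) hs.
near=> s.
have ha : `|r * cos t - r * cos s| < complex.Re e / 2 by near: s.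
have hb : `|r * sin t - r * sin s| < complex.Re e / 2 by near: s.
rewrite -ball_normE /ball_ /= eE /circle_point.
rewrite opprD addrACA subrr add0r normc_def ltcR /=.
have -> : complex.Re e = `|complex.Re e| by rewrite gtr0_norm.
rewrite -sqrtr_sqr ltr_sqrt ?exprn_gt0//.
have {1}-> : complex.Re e = complex.Re e / 2 + complex.Re e / 2.
  by rewrite -splitr.
rewrite -[X in X + _]real_normK ?num_real// -[X in _ + X]real_normK ?num_real//.
rewrite sqrrD.
rewrite -addrA ltrD//; first by rewrite ltr_pXn2r// ?nnegrE// ltW.
apply: lt_le_trans (_ : (complex.Re e / 2) ^+ 2 <= _).
  by rewrite ltr_pXn2r// ?nnegrE// ltW.
by rewrite lerDr mulrn_wge0// mulr_ge0// ltW.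
Unshelve. all: by end_near. Qed.

(** Polar coordinates about z.  The angle is an arc cosine in the upper half
    plane and its reflection in the lower one. *)
Lemma circle_point_onto (R : realType) (z w : Cplx R) :
  exists2 t : R, t \in `[0, 2 * pi] &
    w = circle_point z (Normc.normc (w - z)) t.
Proof.
suff [t tI wE] : exists2 t : R, t \in `[0, 2 * pi] &
    (w - z : R[i]) = ((Normc.normc (w - z) * cos t) +i*
                   (Normc.normc (w - z) * sin t))%C.
  by exists t => //; rewrite /circle_point -wE addrC subrK.
case: (w - z : R[i]) => x y; set r := Normc.normc _.
have pi0 := @pi_ge0 R.
have [r0|r_neq0] := eqVneq r 0.
  have [-> ->] := @Normc.eq0_normc R (x +i* y)%C r0.
  by exists 0; rewrite ?in_itv/= ?lexx ?mulr_ge0// r0 !mul0r.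
have r0 : 0 < r by rewrite lt_def r_neq0 sqrtr_ge0.
have r2 : r ^+ 2 = x ^+ 2 + y ^+ 2 by rewrite sqr_sqrtr// addr_ge0// sqr_ge0.
have xr : -1 <= x / r <= 1.
  rewrite -ler_norml normrM normfV (gtr0_norm r0) ler_pdivrMr// mul1r.
  rewrite -(@ler_pXn2r _ 2)// ?nnegrE ?(ltW r0)// r2 real_normK ?num_real//.
  by rewrite lerDl sqr_ge0.
have cE : r * cos (acos (x / r)) = x by rewrite acosK// mulrC divfK.
have sE : r * sin (acos (x / r)) = `|y|.
  rewrite sin_acos// -{1}(gtr0_norm r0) -sqrtr_sqr -sqrtrM ?sqr_ge0//.
  rewrite mulrBr mulr1 -exprMn mulrC divfK// r2.
  by rewrite addrC addKr sqrtr_sqr.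
have a0 := acos_ge0 xr; have api := acos_lepi xr.
have [y0|y0] := leP 0 y.
  exists (acos (x / r)); last by rewrite cE sE ger0_norm.
  by rewrite in_itv/= a0 (le_trans api)// mulr_natl mulr2n lerDl.
exists (- acos (x / r) + pi *+ 2).
  rewrite in_itv/= mulr_natl addrC subr_ge0 gerBl a0 andbT.
  by rewrite (le_trans api)// mulr2n lerDl.
by rewrite cosD2pi sinD2pi cosN sinN mulrN cE sE ltr0_norm// opprK.
Qed.

(** * Circle means of continuous functions *)

Lemma continuous_integrable_itv (R : realType) (a b : R) (h : R -> R) :
  continuous h ->
  (@lebesgue_measure R).-integrable `[a, b]%classic (EFin \o h).
Proof.
move=> ch; apply: continuous_compact_integrable; first exact: segment_compact.
exact: continuous_subspaceT.
Qed.

(** If h were positive at x, it would exceed h x / 2 on a nondegenerate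
    subinterval, which would make the integral positive. *)
Lemma continuous_ge0_integral_le0 (R : realType) (a b : R) (h : R -> R) :
  a < b -> continuous h -> (forall x, 0 <= h x) ->
  (\int[lebesgue_measure]_(x in `[a, b]) (h x)%:E <= 0)%E ->
  forall x, x \in `[a, b] -> h x = 0.
Proof.
move=> ab ch h0 ih x; rewrite in_itv/= => /andP[ax xb]; apply/eqP.
rewrite eq_le h0 andbT leNgt; apply/negP => hx.
have hx2 : 0 < h x / 2 by rewrite divr_gt0.
have /cvgrPdist_lt /(_ _ hx2) /nbhs_ballP[d /= d0 xd] := ch x.
(* clipping to [a, b] keeps positive length also when x is an end point *)
pose c := Num.max a (x - d / 2); pose e := Num.min b (x + d / 2).
have ce : c < e.
  by rewrite /c /e gt_max !lt_min; apply/andP; split; apply/andP; split; lra.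
have mh p q := measurable_int _ (continuous_integrable_itv p q ch).
have sub : `[c, e]%classic `<=` `[a, b]%classic.
  move=> y /=; rewrite !in_itv/= /c /e ge_max le_min.
  by move=> /andP[/andP[-> _] /andP[-> _]].
have hce y : `[c, e]%classic y -> h x / 2 <= h y.
  rewrite /= in_itv/= /c /e ge_max le_min => /andP[/andP[_ xy] /andP[_ yx]].
  have /xd : ball x d y.
    by rewrite /ball /= ltr_norml; apply/andP; split; lra.
  by rewrite /= ltr_norml => /andP[_]; lra.
have := ih; rewrite leNgt => /negP; apply.
apply: (@lt_le_trans _ _
    (\int[lebesgue_measure]_(y in `[c, e]) (h x / 2)%:E)%E).
  rewrite integral_cst//= lebesgue_measure_itv /= lte_fin ce -EFinB -EFinM.
  by rewrite lte_fin mulr_gt0// subr_gt0.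
apply: (@le_trans _ _ (\int[lebesgue_measure]_(y in `[c, e]) (h y)%:E)%E).
  by apply: ge0_le_integral => // y _; rewrite lee_fin ltW.
by apply: ge0_subset_integral => // y _; rewrite lee_fin.
Qed.

Lemma circle_mean_linear (R : realType) (f g : Cplx R -> R) (a : R)
    (z : Cplx R) (r : R) :
  continuous (f \o circle_point z r) -> continuous (g \o circle_point z r) ->
  circle_mean (fun w => f w + a * g w) z r =
  (circle_mean f z r + a%:E * circle_mean g z r)%E.
Proof.
move=> cf cg; rewrite /circle_mean.
have If := continuous_integrable_itv 0 (2 * pi) cf.
have Ig := continuous_integrable_itv 0 (2 * pi) cg.
rewrite muleCA -(integralZl _ Ig)//.
rewrite -muleDr//; last exact/fin_num_adde_defr/integrable_fin_num.
by congr (_ * _)%E; rewrite -integralD//; exact: integrableZl.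
Qed.

(** A mean can only reach an upper bound m of the continuous integrand if the
    integrand is m everywhere: the nonnegative function m - f integrates to at
    most 0 over the circle. *)
Lemma circle_mean_max (R : realType) (f : Cplx R -> R) (z : Cplx R) (r m : R) :
  continuous (f \o circle_point z r) ->
  (forall t, f (circle_point z r t) <= m) ->
  (m%:E <= circle_mean f z r)%E ->
  forall t, t \in `[0, 2 * pi] -> f (circle_point z r t) = m.
Proof.
move=> cf fm mf t tI; have pi0 : 0 < 2 * pi :> R by rewrite mulr_gt0// pi_gt0.
apply/eqP; rewrite eq_sym -subr_eq0; apply/eqP.
have cm : continuous (cst m : R -> R) by exact: cst_continuous.
have If := continuous_integrable_itv 0 (2 * pi) cf.
have Im := continuous_integrable_itv 0 (2 * pi) cm.
pose h s := m - f (circle_point z r s).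
apply: (continuous_ge0_integral_le0 (h := h) pi0) => //.
- by move=> s; apply: continuousB; [exact: cm|exact: cf].
- by move=> s; rewrite /h subr_ge0.
rewrite (integralB_EFin _ Im If)// (@integral_cst _ _ _ _ _ _ m%:E)//=.
rewrite lebesgue_measure_itv /=.
move: mf; rewrite /circle_mean.
rewrite -(fineK (integrable_fin_num _ If))//; set F := fine _.
rewrite lte_fin pi0 -EFinM lee_fin mulrC ler_pdivlMr// => mF.
by rewrite sube0 -EFinM -EFinB lee_fin subr_le0.
Qed.

(** * Subharmonic functions in the plane *)

Lemma continuous_circle (R : realType) (f : Cplx R -> R) (z : Cplx R)
    (e r : R) :
  (forall w, Normc.normc (w - z) < e -> {for w, continuous f}) ->
  0 <= r < e -> continuous (f \o circle_point z r).
Proof.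
move=> cf /andP[r0 re] t; apply: continuous_comp.
  exact: continuous_circle_point.
by apply: cf; rewrite normc_circle_point ger0_norm.
Qed.

(** Continuity serves twice: it gives upper semicontinuity of the combination,
    and it makes the circle means finite, hence additive. *)
Lemma subharmonic_plane_linear (R : realType) (D : set (Cplx R))
    (f g : Cplx R -> R) (a : R) :
  open D -> {in D, continuous f} -> {in D, continuous g} -> 0 <= a ->
  subharmonic_plane D f -> subharmonic_plane D g ->
  subharmonic_plane D (fun w => f w + a * g w).
Proof.
move=> oD cf cg a0 [_ sf] [_ sg]; split=> [z b Dz fzb|z Dz].
  have : {for z, continuous (fun w => f w + a * g w)}.
    apply: continuousD; first by apply: cf; rewrite inE.
    by apply: continuousM; [exact: cst_continuous|apply: cg; rewrite inE].
  move/(_ [set y | y < b]) => /(_ (lt_nbhsl fzb)) fb.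
  have {}fb : \forall w \near z, f w + a * g w < b by [].
  by apply: filterS fb.
have [e e0 eD] := complex_ball_sub (open_nbhs_nbhs (conj oD Dz)).
have [p p0 pf] := sf z Dz; have [q q0 qg] := sg z Dz.
exists (Num.min e (Num.min p q)); first by rewrite !lt_min e0 p0.
move=> r; rewrite !lt_min => /andP[r0 /and3P[re rp rq]].
rewrite circle_mean_linear.
- rewrite EFinD EFinM leeD//; first by rewrite pf// r0.
  by rewrite lee_wpmul2l ?lee_fin// qg// r0.
- apply: (@continuous_circle _ _ _ e); last by rewrite r0.
  by move=> w /eD Dw; apply: cf; rewrite inE.
- apply: (@continuous_circle _ _ _ e); last by rewrite r0.
  by move=> w /eD Dw; apply: cg; rewrite inE.
Qed.

(** Every w near z lies on the circle of radius |w - z| about z, and on that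
    circle the submean inequality forces f to reach its upper bound f z. *)
Lemma subharmonic_plane_max (R : realType) (D : set (Cplx R))
    (f : Cplx R -> R) (z : Cplx R) :
  open D -> {in D, continuous f} -> subharmonic_plane D f -> D z ->
  (\forall w \near z, f w <= f z) -> \forall w \near z, f w = f z.
Proof.
move=> oD cf [_ sf] Dz fz.
have [e e0 eD] := complex_ball_sub (filterI (open_nbhs_nbhs (conj oD Dz)) fz).
have [p p0 pf] := sf z Dz.
have d0 : 0 < Num.min e p by rewrite lt_min e0.
apply: filterS (nbhs_complex_ball z d0) => w /=; rewrite lt_min => /andP[we wp].
have r0 : 0 <= Normc.normc (w - z).
  by case: (w - z : R[i]) => x y /=; exact: sqrtr_ge0.
have [t tI wE] := circle_point_onto z w.
rewrite {1}wE; apply: circle_mean_max tI.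
- apply: (@continuous_circle _ _ _ e); last by rewrite r0.
  by move=> y /eD[Dy _]; apply: cf; rewrite inE.
- by move=> s; apply: (eD _ _).2; rewrite normc_circle_point ger0_norm.
- by apply: pf; rewrite r0.
Qed.

(** * Transfer through a chart *)

Section Chart.
Context (R : realType) (M : topologicalType) (c : chart R M).

Lemma chart_mapE (x : M) : chart_dom c x -> chart_inv c (chart_map c x) = x.
Proof. by move=> dx; apply: chart_mapK; rewrite inE. Qed.

Lemma chart_invE (w : Cplx R) :
  chart_cod c w -> chart_map c (chart_inv c w) = w.
Proof. by move=> cw; apply: chart_invK; rewrite inE. Qed.

(** Together with [near_chart_map]: a property holds near x on the surface if
    and only if its reading in the chart holds near the image of x. *)
Lemma near_chart_inv (P : M -> Prop) (x : M) : chart_dom c x ->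
  (\forall y \near x, P y) -> \forall w \near chart_map c x, P (chart_inv c w).
Proof.
move=> dx Px; have := @chart_inv_continuous _ _ c.
rewrite continuous_open_subspace; last exact: chart_cod_open.
move=> /(_ (chart_map c x)); rewrite inE => /(_ (chart_mapP dx)).
by rewrite /prop_for /continuous_at chart_mapE//; exact.
Qed.

Lemma near_chart_map (P : M -> Prop) (x : M) : chart_dom c x ->
  (\forall w \near chart_map c x, P (chart_inv c w)) -> \forall y \near x, P y.
Proof.
move=> dx Px; have := @chart_map_continuous _ _ c.
rewrite continuous_open_subspace; last exact: chart_dom_open.
move=> /(_ x); rewrite inE => /(_ dx)/(_ _ Px) /= Py.
have dy : \forall y \near x, chart_dom c y.
  by apply: open_nbhs_nbhs; split=> //; exact: chart_dom_open.
by apply: filterS2 dy Py => y dy /=; rewrite chart_mapE//.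
Qed.

Lemma open_chart_image (A : set M) :
  open A -> open (chart_map c @` (chart_dom c `&` A)).
Proof.
move=> oA; rewrite openE => _ [x [dx Ax] <-].
have Ay : \forall y \near x, A y by exact: open_nbhs_nbhs.
have cw : \forall w \near chart_map c x, chart_cod c w.
  by apply: open_nbhs_nbhs; split; [exact: chart_cod_open|exact: chart_mapP].
apply: filterS2 cw (near_chart_inv dx Ay) => w cw Aw.
by exists (chart_inv c w); [split=> //; exact: chart_invP|rewrite chart_invE//].
Qed.

Lemma continuous_comp_chart_inv (A : set M) (T : topologicalType) (u : M -> T) :
  open A -> {within A, continuous u} ->
  {in chart_map c @` (chart_dom c `&` A), continuous (u \o chart_inv c)}.
Proof.
move=> oA; rewrite continuous_open_subspace// => cu z.
rewrite inE => -[x [dx Ax] <-].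
move=> B /=; rewrite chart_mapE// => Bx.
apply: (@near_chart_inv (u @^-1` B)) => //.
by apply: cu; rewrite ?inE.
Qed.

End Chart.

(** * The maximum principle on a Riemann surface *)

Section RiemannSurface.
Context (R : realType) (M : riemannSurface R) (Omega : set M).
Hypothesis (oOmega : open Omega).

Lemma subharmonic_linear (u v : M -> R) (a : R) :
  {within Omega, continuous u} -> {within Omega, continuous v} -> 0 <= a ->
  subharmonic Omega u -> subharmonic Omega v ->
  subharmonic Omega (fun x => u x + a * v x).
Proof.
move=> cu cv a0 su sv c cM.
apply: (@subharmonic_plane_linear _ _
  (u \o chart_inv c) (v \o chart_inv c)) => //.
- exact: open_chart_image.
- exact: continuous_comp_chart_inv.
- exact: continuous_comp_chart_inv.
- exact: su.
- exact: sv.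
Qed.

Lemma subharmonic_local_max (u : M -> R) (x : M) :
  {within Omega, continuous u} -> subharmonic Omega u -> Omega x ->
  (\forall y \near x, u y <= u x) -> \forall y \near x, u y = u x.
Proof.
move=> cu su Ox ux; have [c cM dx] := rs_cover x.
apply: (near_chart_map dx).
have xE : chart_inv c (chart_map c x) = x by rewrite chart_mapE//.
have sc := su c cM.
have := subharmonic_plane_max (open_chart_image oOmega)
  (continuous_comp_chart_inv oOmega cu) sc (z := chart_map c x).
rewrite /= xE; apply; first by exists x.
exact: (near_chart_inv dx ux).
Qed.

(** The set where the bound is attained is open by [subharmonic_local_max],
    closed because it is compact, and nonempty; the surface is connected.
    Compactness is what replaces a condition on the boundary of U. *)
Lemma strong_maximum_principle (u : M -> R) (U : set M) (m : R) :
  {within Omega, continuous u} -> subharmonic Omega u ->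
  open U -> U `<=` Omega -> (forall x, U x -> u x <= m) ->
  compact [set x | U x /\ u x = m] -> [set x | U x /\ u x = m] !=set0 ->
  U = setT.
Proof.
move=> cu su oU UO um cE E0.
have oE : open [set x | U x /\ u x = m].
  rewrite openE => x [Ux uxm].
  have nU : \forall y \near x, U y by exact: open_nbhs_nbhs.
  have nm : \forall y \near x, u y <= u x.
    by apply: filterS nU => y; rewrite uxm; exact: um.
  apply: filterS2 nU (subharmonic_local_max cu su (UO _ Ux) nm) => y Uy uyx.
  by split=> //; rewrite uyx.
have ET : [set x | U x /\ u x = m] = setT.
  apply: (@rs_connected _ M) => //.
  - by exists [set x | U x /\ u x = m]; rewrite ?setTI.
  - exists [set x | U x /\ u x = m]; rewrite ?setTI//.
    by apply: compact_closed => //; exact: rs_hausdorff.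
by rewrite -subTset -ET => x [].
Qed.

End RiemannSurface.

(** * Level sets of a proper superharmonic function *)

Lemma range_interval_itv (R : realType) (T : Type) (Omega : set T) (v : T -> R)
    (p q : R) :
  range_interval Omega v p -> range_interval Omega v q ->
  `[p, q]%classic `<=` range_interval Omega v.
Proof.
move=> /andP[ip _] /andP[_ sq] t /=; rewrite in_itv/= => /andP[pt tq].
apply/andP; split; [apply: lt_le_trans ip _|apply: le_lt_trans sq];
  by rewrite lee_fin.
Qed.

Section LevelSets.
Context (R : realType) (M : riemannSurface R) (Omega : set M) (u v : M -> R).
Hypothesis oOmega : open Omega.
Hypothesis cu : {within Omega, continuous u}.
Hypothesis cv : {within Omega, continuous v}.
Hypothesis su : subharmonic Omega u.
Hypothesis sv : superharmonic Omega v.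
Local Notation J := (range_interval Omega v).
Hypothesis pv : proper_on Omega J v.

Let cNv : {within Omega, continuous (fun x => - v x)}.
Proof. by move=> x; apply: continuousN; exact: cv. Qed.

Lemma open_preimage_on (A : set R) : open A -> open (Omega `&` v @^-1` A).
Proof.
move=> oA; apply: (continuous_inP v oOmega).1 => //.
by rewrite -continuous_open_subspace.
Qed.

Lemma compact_slab (p q : R) :
  J p -> J q -> compact [set x | Omega x /\ p <= v x <= q].
Proof.
move=> Jp Jq.
have := pv.2 _ (@segment_compact _ p q) (range_interval_itv Jp Jq).
congr compact; apply/seteqP; split=> x /=; rewrite in_itv/=; tauto.
Qed.

Lemma lt_sup_on (t : R) : J t -> exists2 x, Omega x & t < v x.
Proof.
by move=> /andP[_ /ereal_sup_gt[_ [x Ox <-]]]; rewrite lte_fin => tx; exists x.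
Qed.

Lemma inf_on_lt (t : R) : J t -> exists2 x, Omega x & v x < t.
Proof.
move=> /andP[/ereal_inf_lt[_ [x Ox <-] +] _]; rewrite lte_fin => tx.
by exists x.
Qed.

(** Suppose that v omits t, and let i be the least value of v above t; it exists
    because slabs are compact.  Then {v = i} is the set of minimum points of v
    on the open set {t < v}, and it is compact, so by the maximum principle for
    - v that open set is the whole surface; but v takes values below t. *)
Lemma level_set_neq0 (t : R) : J t -> level_set Omega v t !=set0.
Proof.
move=> Jt; apply: contrapT => /set0P/negP/negPn/eqP vt.
have vNt x : Omega x -> v x != t.
  move=> Ox; apply/eqP => vxt; suff : level_set Omega v t x by rewrite vt.
  by split.
have [x0 Ox0 tx0] := lt_sup_on Jt.
pose K := [set x | Omega x /\ t <= v x <= v x0].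
have cK : compact K by apply: compact_slab => //; exact: pv.1.
have KO : K `<=` Omega by move=> x [].
have K0 : K !=set0 by exists x0; split=> //; rewrite lexx ltW.
have [x1 x1K x1min] := compact_EVT_min K0 cK (continuous_subspaceW KO cv).
move: x1K; rewrite inE => -[Ox1 /andP[tx1 x10]].
have {}tx1 : t < v x1 by rewrite lt_def vNt.
pose U := Omega `&` v @^-1` `]t, +oo[%classic.
have oU : open U by apply: open_preimage_on; exact: interval_open.
have UE x : U x = (Omega x /\ t < v x).
  by rewrite /U /setI /= in_itv/= andbT.
have Umin x : U x -> - v x <= - v x1.
  rewrite UE lerN2 => -[Ox tx]; have [x0x|xx0] := ltP (v x0) (v x).
    exact: le_trans x10 (ltW x0x).
  by apply: x1min; rewrite inE; split=> //; rewrite ltW.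
have EE : [set x | U x /\ - v x = - v x1] =
          [set x | Omega x /\ v x1 <= v x <= v x1].
  apply/seteqP; split=> x /=; rewrite UE.
    by move=> [[Ox _] /oppr_inj ->]; rewrite lexx.
  by move=> [Ox]; rewrite -eq_le => /eqP <-.
have UT : U = setT.
  apply: (strong_maximum_principle oOmega cNv sv oU) Umin _ _.
  - by move=> x [].
  - by rewrite EE; apply: compact_slab; exact: pv.1.
  - by rewrite EE; exists x1; rewrite /= lexx.
have [y Oy yt] := inf_on_lt Jt.
have : U y by rewrite UT.
by rewrite UE => -[_ /(lt_trans yt)]; rewrite ltxx.
Qed.

Lemma level_max_spec (t : R) : J t ->
  (exists2 x, level_set Omega v t x & level_max Omega u v t = u x) /\
  (forall x, level_set Omega v t x -> u x <= level_max Omega u v t).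
Proof.
move=> Jt; have S0 := level_set_neq0 Jt.
have SE : level_set Omega v t = [set x | Omega x /\ t <= v x <= t].
  apply/seteqP; split=> x [Ox]; first by move=> vx; split=> //; rewrite vx lexx.
  by rewrite -eq_le => /eqP.
have cS : compact (level_set Omega v t) by rewrite SE; exact: compact_slab.
have SO : level_set Omega v t `<=` Omega by move=> x [].
have [x xS xmax] := compact_EVT_max S0 cS (continuous_subspaceW SO cu).
rewrite inE in xS.
pose A := u @` level_set Omega v t.
have : [set m | A m /\ ubound A m] (level_max Omega u v t).
  apply: (@xgetPex _ 0); exists (u x); split; first by exists x.
  by move=> _ [y Sy <-]; apply: xmax; rewrite inE.
move=> [[y Sy <-] ub]; split; first by exists y.
by move=> z Sz; apply: ub; exists z.
Qed.

(** The comparison with an affine function of v, which the maximum principle for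
    w = u - a v extends from the two bounding level sets to the slab. *)
Lemma chord_bound (p q a b : R) : 0 <= a -> J p -> J q ->
  level_max Omega u v p <= a * p + b -> level_max Omega u v q <= a * q + b ->
  forall x, Omega x -> p <= v x <= q -> u x <= a * v x + b.
Proof.
move=> a0 Jp Jq mp mq x Ox pxq.
pose w y := u y + a * - v y.
have cw : {within Omega, continuous w}.
  move=> y; apply: cvgD; first exact: cu.
  by apply: cvgM; [exact: cvg_cst|exact: cNv].
have sw : subharmonic Omega w by exact: subharmonic_linear.
(* w <= b on the two level sets bounding the slab *)
have wb y : Omega y -> p <= v y <= q -> ~ p < v y < q -> w y <= b.
  move=> Oy /andP[py yq] pyq; rewrite /w mulrN lerBlDl.
  have [pE|py'] := eqVneq p (v y).
    by rewrite -pE (le_trans _ mp)//; apply: (level_max_spec Jp).2; split.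
  have [qE|yq'] := eqVneq q (v y).
    by rewrite -qE (le_trans _ mq)//; apply: (level_max_spec Jq).2; split.
  by exfalso; apply: pyq; rewrite !lt_neqAle py' py yq eq_sym yq'.
pose K := [set y | Omega y /\ p <= v y <= q].
have cK : compact K by exact: compact_slab.
have KO : K `<=` Omega by move=> y [].
have K0 : K !=set0 by exists x.
have [z zK zmax] := compact_EVT_max K0 cK (continuous_subspaceW KO cw).
rewrite inE in zK; rewrite -lerBlDl -mulrN.
apply: (@le_trans _ _ (w z)); first by apply: zmax; rewrite inE.
rewrite leNgt; apply/negP => bz.
(* a maximum above b cannot be attained on the bounding level sets *)
have inner y : K y -> w y = w z -> p < v y < q.
  move=> [Oy pyq] yz; apply: contrapT => /(wb _ Oy pyq).
  by rewrite yz leNgt bz.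
pose U := Omega `&` v @^-1` `]p, q[%classic.
have oU : open U by apply: open_preimage_on; exact: interval_open.
have UE y : U y = (Omega y /\ p < v y < q) by rewrite /U /setI /= in_itv/=.
have UK : U `<=` K.
  move=> y; rewrite UE => -[Oy /andP[/ltW py /ltW yq]].
  by split=> //; rewrite py.
pose E := [set y | U y /\ w y = w z].
have EE : E = K `&` w @^-1` [set w z].
  apply/seteqP; split=> y; rewrite /E /=; first by move=> [/UK].
  by move=> [Ky yz]; rewrite UE; split=> //; split; [exact: KO|exact: inner].
have E0 : E !=set0 by exists z; rewrite EE.
have cE : compact E.
  rewrite EE; have := continuous_subspaceW KO cw.
  move/continuous_closedP => /(_ _ (@closed_eq _ (w z))).
  move/closed_subspaceP => [V cV]; rewrite !(setIC _ K) => <-.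
  exact: compact_closedI.
have UT : U = setT.
  apply: (strong_maximum_principle oOmega cw sw oU _ _ cE E0).
  - by move=> y [].
  - by move=> y Uy; apply: zmax; rewrite inE; exact: UK.
have [y Oy qy] := lt_sup_on Jq.
have : U y by rewrite UT.
by rewrite UE => -[_ /andP[_ /(lt_trans qy)]]; rewrite ltxx.
Qed.

End LevelSets.

(** * Convexity of the maximum *)

Theorem theorem1p2 (R : realType) (M : riemannSurface R) (Omega : set M)
    (u v : M -> R) :
  open Omega ->
  {within Omega, continuous u} ->
  {within Omega, continuous v} ->
  subharmonic Omega u ->
  superharmonic Omega v ->
  proper_on Omega (range_interval Omega v) v ->
  {in range_interval Omega v &, {homo level_max Omega u v : t s / t <= s}} ->
  convex_function (range_interval Omega v) (level_max Omega u v).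
Proof.
move=> oO cu cv su sv pv mono.
set m := level_max Omega u v in mono *.
(* the chord inequality, cleared of the denominator q - p *)
have chord p q s : range_interval Omega v p -> range_interval Omega v q ->
    p < q -> p <= s <= q -> (q - p) * m s <= (q - s) * m p + (s - p) * m q.
  move=> Jp Jq pq psq; have qp0 : 0 < q - p by rewrite subr_gt0.
  have Js : range_interval Omega v s.
    by apply: (range_interval_itv Jp Jq); rewrite /= in_itv.
  (* the slope of the chord is nonnegative because m is increasing *)
  pose a := (m q - m p) / (q - p).
  have aE : (q - p) * a = m q - m p by rewrite mulrC divfK ?gt_eqF.
  have a0 : 0 <= a by rewrite divr_ge0 ?(ltW qp0)// subr_ge0 mono ?inE// ltW.
  have [[x [Ox vx] mx] _] := level_max_spec oO cu cv sv pv Js.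
  rewrite /m mx.
  have mp : m p <= a * p + (m p - a * p) by lra.
  have mq : m q <= a * q + (m p - a * p) by lra.
  have := chord_bound oO cu cv su sv pv a0 Jp Jq mp mq Ox.
  rewrite vx => /(_ psq); rewrite -(ler_pM2l qp0) => /le_trans; apply.
  have -> : (q - p) * (a * s + (m p - a * p)) =
            (q - p) * m p + (q - p) * a * (s - p) by ring.
  by rewrite aE /m; nra.
have convex p q T : range_interval Omega v p -> range_interval Omega v q ->
    0 <= T -> T <= 1 -> m (T * p + (1 - T) * q) <= T * m p + (1 - T) * m q.
  move=> Jp Jq t0 t1; case: (ltgtP p q) => [pq|qp|<-].
  - rewrite -(@ler_pM2l _ (q - p)) ?subr_gt0//.
    apply: le_trans (chord p q _ Jp Jq pq _) _; first by apply/andP; split; nra.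
    by nra.
  - rewrite -(@ler_pM2l _ (p - q)) ?subr_gt0//.
    apply: le_trans (chord q p _ Jq Jp qp _) _; first by apply/andP; split; nra.
    by nra.
  - by rewrite -!mulrDl addrC subrK !mul1r.
by move=> t p q; rewrite !inE => Jp Jq; exact: convex.
Qed.
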